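(* For each natural number $M$, as formal power series in $q$, $$\sum_{n\ge1}\frac{q^{nM+n}}{(1-q^{n})^2(1-q^{n+1})\cdots(1-q^{n+M})} =\frac{1}{(q;q)_{M}}\sum_{n\ge1}\frac{nq^n}{1-q^n}+(q;q)_{M}\sum_{n\ge1}\frac{(-1)^nq^{n(n+1)/2}(1+q^n)}{(q;q)_{M-n}(q;q)_{M+n}(1-q^n)^2}.$$
   Context: Notation: $(a;q)_n=\prod_{k=0}^{n-1}(1-aq^k)$ for $n\ge0$; for negative $k$ one uses the convention $1/(q;q)_{k}=0$, so the last sum effectively runs over $1\le n\le M$. *)

(* Defs.v *)
From HB Require Import structures.
From mathcomp Require Import all_boot all_order all_algebra.
From mathcomp Require Import boolp classical_sets cardinality fsbigop.

Set Implicit Arguments.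
Unset Strict Implicit.
Unset Printing Implicit Defensive.

Import GRing.Theory.

Local Open Scope ring_scope.

(* The ring R[[q]].  A record, so that its product is not confused with the
   pointwise product that mathcomp-classical puts on [nat -> R]. *)
Record fps (R : Type) := Fps { fcoef : nat -> R }.

HB.instance Definition _ (R : Type) := gen_eqMixin (fps R).
HB.instance Definition _ (R : Type) := gen_choiceMixin (fps R).

Lemma fpsP (R : Type) (f g : fps R) : (forall k, fcoef f k = fcoef g k) <-> f = g.
Proof.
by split=> [fg|-> //]; case: f g fg => f [g] /= fg; congr Fps; apply/funext.
Qed.

Section Ring.
Variable R : comNzRingType.
Implicit Types f g h : fps R.

Definition fps0 : fps R := Fps (fun=> 0).
Definition fps1 : fps R := Fps (fun k => (k == 0%N)%:R).
Definition fps_opp f : fps R := Fps (fun k => - fcoef f k).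
Definition fps_add f g : fps R := Fps (fun k => fcoef f k + fcoef g k).
Definition fps_mul f g : fps R :=
  Fps (fun k => \sum_(i < k.+1) fcoef f i * fcoef g (k - i)).

Definition fps_trunc n f : {poly R} := \poly_(i < n) fcoef f i.

Lemma coef_fps_mul_poly n (p r : {poly R}) f g k : (k < n)%N ->
  (forall i, (i < n)%N -> p`_i = fcoef f i) ->
  (forall i, (i < n)%N -> r`_i = fcoef g i) ->
  (p * r)`_k = fcoef (fps_mul f g) k.
Proof.
move=> kn pf rg; rewrite coefM; apply: eq_bigr => i _.
by rewrite pf ?rg // ?(leq_ltn_trans (leq_subr _ _)) // (leq_trans (ltn_ord i)).
Qed.

Lemma coef_fps_trunc n f i : (i < n)%N -> (fps_trunc n f)`_i = fcoef f i.
Proof. by move=> ltin; rewrite coef_poly ltin. Qed.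

Lemma coef_fps_mul n f g k : (k < n)%N ->
  (fps_trunc n f * fps_trunc n g)`_k = fcoef (fps_mul f g) k.
Proof.
by move=> kn; apply: coef_fps_mul_poly kn _ _ => i; apply: coef_fps_trunc.
Qed.

Fact fps_addA : associative fps_add.
Proof. by move=> f g h; apply/fpsP => k /=; rewrite addrA. Qed.
Fact fps_addC : commutative fps_add.
Proof. by move=> f g; apply/fpsP => k /=; rewrite addrC. Qed.
Fact fps_add0 : left_id fps0 fps_add.
Proof. by move=> f; apply/fpsP => k /=; rewrite add0r. Qed.
Fact fps_addN : left_inverse fps0 fps_opp fps_add.
Proof. by move=> f; apply/fpsP => k /=; rewrite addNr. Qed.

HB.instance Definition _ :=
  GRing.isZmodule.Build (fps R) fps_addA fps_addC fps_add0 fps_addN.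

Fact fps_mulA : associative fps_mul.
Proof.
move=> f g h; apply/fpsP => k.
rewrite -(@coef_fps_mul_poly k.+1 (fps_trunc k.+1 f)
  (fps_trunc k.+1 g * fps_trunc k.+1 h)) //; first last.
- by move=> i; apply: coef_fps_mul.
- by move=> i; apply: coef_fps_trunc.
rewrite mulrA; apply: (@coef_fps_mul_poly k.+1) => // i.
- exact: coef_fps_mul.
- exact: coef_fps_trunc.
Qed.

Fact fps_mulC : commutative fps_mul.
Proof.
move=> f g; apply/fpsP => k.
by rewrite -!(@coef_fps_mul k.+1) // mulrC.
Qed.

Fact fps_mul1 : left_id fps1 fps_mul.
Proof.
move=> f; apply/fpsP => k /=.
rewrite big_ord_recl /= mul1r subn0 big1 ?addr0 // => i _.
by rewrite /= mul0r.
Qed.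

Fact fps_mulDl : left_distributive fps_mul fps_add.
Proof.
move=> f g h; apply/fpsP => k /=; rewrite -big_split /=.
by apply: eq_bigr => i _; rewrite mulrDl.
Qed.

Fact fps_oner_neq0 : fps1 != 0 :> fps R.
Proof.
by apply/eqP => /fpsP/(_ 0%N) /= /eqP; rewrite oner_eq0.
Qed.

HB.instance Definition _ := GRing.Zmodule_isComNzRing.Build (fps R)
  fps_mulA fps_mulC fps_mul1 fps_mulDl fps_oner_neq0.

Definition fpsX : fps R := Fps (fun k => (k == 1%N)%:R).

(* Sum of the [F n], n in A, in R[[q]].  [\sum_(n \in A)] is a finite-support
   sum with default value 0, hence meaningful only for summable families. *)
Definition fps_summable (A : set nat) (F : nat -> fps R) : Prop :=
  forall k, finite_set [set n | A n /\ fcoef (F n) k <> 0].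

Definition fps_sum (A : set nat) (F : nat -> fps R) : fps R :=
  Fps (fun k => \sum_(n \in A) fcoef (F n) k).

End Ring.

Section Units.
Variable R : comUnitRingType.
Implicit Types f g : fps R.

Definition fps_unit : pred (fps R) := fun f => fcoef f 0 \is a GRing.unit.

(* The first n coefficients of f^-1, from the equations
   f_0 g_0 = 1 and sum_(i <= m) f_(m-i) g_i = 0 for m > 0. *)
Fixpoint fps_inv_seq f (n : nat) : seq R :=
  if n is m.+1 then
    let s := fps_inv_seq f m in
    rcons s ((fcoef f 0)^-1 *
             ((m == 0%N)%:R - \sum_(i < m) fcoef f (m - i) * s`_i))
  else [::].

Definition fps_inv f : fps R :=
  if fps_unit f then Fps (fun k => (fps_inv_seq f k.+1)`_k) else f.

Lemma size_fps_inv_seq f n : size (fps_inv_seq f n) = n.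
Proof. by elim: n => //= n IHn; rewrite size_rcons IHn. Qed.

Lemma nth_fps_inv_seq f n i : (i < n)%N ->
  (fps_inv_seq f n)`_i = (fps_inv_seq f i.+1)`_i.
Proof.
elim: n => // n IHn; rewrite ltnS leq_eqVlt => /predU1P[-> //|ltin].
by rewrite [LHS]nth_rcons size_fps_inv_seq ltin IHn.
Qed.

Fact fps_mulVr : {in fps_unit, left_inverse 1 fps_inv *%R}.
Proof.
move=> f uf; have uf' : fps_unit f by [].
rewrite mulrC /fps_inv uf'; apply/fpsP => k.
transitivity (\sum_(i < k.+1) fcoef f (k - i) * (fps_inv_seq f i.+1)`_i).
  rewrite [RHS](reindex_inj rev_ord_inj); apply: eq_bigr => i _.
  by rewrite /= subSS subKn // -ltnS.
rewrite big_ord_recr subnn.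
have -> : (fps_inv_seq f k.+1)`_k = (fcoef f 0)^-1 *
    ((k == 0%N)%:R - \sum_(i < k) fcoef f (k - i) * (fps_inv_seq f k)`_i).
  by rewrite nth_rcons size_fps_inv_seq ltnn eqxx.
have -> : \sum_(i < k) fcoef f (k - i) * (fps_inv_seq f k)`_i =
    \sum_(i < k) fcoef f (k - i) * (fps_inv_seq f i.+1)`_i.
  by apply: eq_bigr => i _; rewrite (@nth_fps_inv_seq f k i).
by rewrite mulVKr //= addrC subrK.
Qed.

Fact fps_unitP f g : g * f = 1 -> fps_unit f.
Proof.
move=> /fpsP/(_ 0%N) /=; rewrite big_ord1 subnn => gf.
by apply/unitrPr; exists (fcoef g 0); rewrite mulrC.
Qed.

Fact fps_inv_out : {in [predC fps_unit], fps_inv =1 id}.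
Proof. by move=> f f_out; rewrite /fps_inv ifN. Qed.

HB.instance Definition _ := GRing.ComNzRing_hasMulInverse.Build (fps R)
  fps_mulVr fps_unitP fps_inv_out.

End Units.

Section QPochhammer.
Variable A : comUnitRingType.
Implicit Types (a q : A).

Definition qpoch a q (n : nat) : A := \prod_(k < n) (1 - a * q ^+ k).

(* 1 / (q;q)_k for an integer k, with the convention that it is 0 for k < 0 *)
Definition inv_qpochqq q (k : int) : A :=
  if k is Posz n then (qpoch q q n)^-1 else 0.

End QPochhammer.

(* Main.v *)
(* Write P_M = (q;q)_M, S_M for the sum on the left and H_M for the last sum.
   By induction on M, P_M S_M = \sum_n n q^n / (1 - q^n) + P_M^2 H_M.  For M = 0
   both sides are the double sum of n q^(mn), and H_0 = 0.  From M - 1 to M,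
   the identity
     (1 - q^M)^2 - (1 - q^(M-n)) (1 - q^(M+n)) = q^(M-n) (1 - q^n)^2
   cancels the denominators (1 - q^n)^2 in P_M^2 H_M - P_(M-1)^2 H_(M-1), and
   the resulting sum telescopes, as does the one for (1 - q^M) S_M - S_(M-1). *)
Require Import Defs.
From mathcomp Require Import all_boot all_order all_algebra.
From mathcomp Require Import boolp classical_sets cardinality fsbigop.
From mathcomp Require Import ring zify.

Import GRing.Theory.

Local Open Scope ring_scope.

(** * Summands and telescoping certificates over an arbitrary commutative ring *)

Definition lhs_term {A : comUnitRingType} (q : A) (M n : nat) : A :=
  q ^+ (n * M + n)
  / ((1 - q ^+ n) ^+ 2 * \prod_(1 <= j < M.+1) (1 - q ^+ (n + j))).

Definition rhs_term {A : comUnitRingType} (q : A) (M n : nat) : A :=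
  (-1) ^+ n * q ^+ (n * (n + 1) %/ 2) * (1 + q ^+ n)
  * inv_qpochqq q (M%:Z - n%:Z) * inv_qpochqq q (M%:Z + n%:Z)
  / (1 - q ^+ n) ^+ 2.

(* Up to constant factors, the forward differences in n of [lhs_cert] and
   [rhs_cert] are the terms of the two telescoping sums. *)
Definition lhs_cert {A : comUnitRingType} (q : A) (M n : nat) : A :=
  q ^+ (n * M.+1)
  / ((1 - q ^+ n) * \prod_(1 <= j < M.+1) (1 - q ^+ (n + j))).

Definition rhs_cert {A : comUnitRingType} (q : A) (M n : nat) : A :=
  (-1) ^+ n * q ^+ (n * (n + 1) %/ 2)
  * inv_qpochqq q (M%:Z - n%:Z) * inv_qpochqq q (M%:Z + n.+1%:Z).

(** * Finite telescoping identities, with only the invertibility of 1 - q^n for n > 0 assumed *)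

Section Telescoping.
Variables (A : comUnitRingType) (q : A).
Hypothesis unit_1Bq : forall n, (0 < n)%N -> 1 - q ^+ n \is a GRing.unit.

Lemma divrMM (a b c : A) : b \is a GRing.unit -> c \is a GRing.unit ->
  a / b = a * c / (b * c).
Proof. by move=> ub uc; rewrite invrM // mulrA mulrK. Qed.

Lemma qpochS n : qpoch q q n.+1 = qpoch q q n * (1 - q ^+ n.+1).
Proof. by rewrite /qpoch big_ord_recr /= -exprS. Qed.

Lemma qpoch_unit n : qpoch q q n \is a GRing.unit.
Proof.
elim: n => [|n IHn]; first by rewrite /qpoch big_ord0 unitr1.
by rewrite qpochS unitrM IHn unit_1Bq.
Qed.

Lemma prod_1Bq_unit n M :
  \prod_(1 <= j < M.+1) (1 - q ^+ (n + j)) \is a GRing.unit.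
Proof.
rewrite big_nat; apply: rpred_prod => j /andP[j_gt0 _].
by rewrite unit_1Bq // addn_gt0 j_gt0 orbT.
Qed.

Lemma inv_qpochqqS n : (qpoch q q n)^-1 =
  (1 - q ^+ n.+1) * (qpoch q q n.+1)^-1.
Proof.
by rewrite qpochS invrM ?qpoch_unit ?unit_1Bq // mulVKr ?unit_1Bq.
Qed.

(** With x = q^n and y = q^(M+1), everything follows over a common denominator from (1 - y) x - (1 -
    x y) = x - 1 on the left and y (1 - x) - (1 - x y) = y - 1 on the right. *)
Lemma lhs_term_step M n : (0 < n)%N ->
  (1 - q ^+ M.+1) * ((1 - q ^+ M.+1) * lhs_term q M.+1 n - lhs_term q M n) =
    lhs_cert q M n.+1 - lhs_cert q M n.
Proof.
move=> n_gt0; rewrite /lhs_term /lhs_cert.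
set D := \prod_(1 <= j < M.+1) (1 - q ^+ (n + j)).
(* Both sides are the product of 1 - q^(n+j) over 1 <= j <= M+1. *)
have De : (1 - q ^+ n.+1) * \prod_(1 <= j < M.+1) (1 - q ^+ (n.+1 + j)) =
    D * (1 - q ^+ n * q ^+ M.+1).
  rewrite -exprD -(big_nat_recr M.+1) // [RHS]big_ltn // addn1; congr (_ * _).
  by rewrite [RHS]big_add1; apply: eq_bigr => j _; rewrite addnS addSn.
have ux := unit_1Bq _ n_gt0.
have uD : D \is a GRing.unit by apply: prod_1Bq_unit.
have ue : 1 - q ^+ n * q ^+ M.+1 \is a GRing.unit.
  by rewrite -exprD unit_1Bq // addnS.
rewrite De big_nat_recr //= -/D.
rewrite -[(n * M + n)%N]mulnSr [(n.+1 * _)%N]mulSn !exprD.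
move: (q ^+ (n * M.+1)) (q ^+ n) (q ^+ M.+1) ux uD ue => Z x y ux uD ue.
(* The first fraction already has denominator (1 - x)^2 D (1 - x y); the other three are brought to
   it. *)
rewrite (divrMM Z (_ * D) (1 - x * y)) ?unitrM ?ux ?uD //.
rewrite (divrMM (y * Z) _ ((1 - x) ^+ 2)) ?unitrM ?ux ?ue ?uD //.
rewrite (divrMM Z (_ * D) ((1 - x) * (1 - x * y))) ?unitrM ?ux ?ue ?uD //.
have -> : D * (1 - x * y) * (1 - x) ^+ 2 = (1 - x) ^+ 2 * (D * (1 - x * y)).
  by ring.
have -> : (1 - x) * D * ((1 - x) * (1 - x * y)) =
    (1 - x) ^+ 2 * (D * (1 - x * y)) by ring.
by rewrite -[_ * D * _]mulrA; ring.
Qed.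

(** The case n = M+1 is included: the left side is then 0 by the convention for negative indices,
    the right side because 1 - q^0 = 0. *)
Lemma inv_qpochqq_subS M n : (n <= M.+1)%N ->
  inv_qpochqq q (M%:Z - n%:Z) =
  (1 - q ^+ (M.+1 - n)) * inv_qpochqq q (M.+1%:Z - n%:Z).
Proof.
rewrite leq_eqVlt => /predU1P[->|]; last rewrite ltnS => le_nM.
  have -> : M%:Z - M.+1%:Z = Negz 0 by lia.
  by rewrite subnn subrr mul0r.
rewrite !subzn // ?(leqW le_nM) //= subSn //; exact: inv_qpochqqS.
Qed.

(** With x = q^(n+1), w = q^(M-n) and y = w x = q^(M+1), the identity (1 - y)^2 - (1 - w) (1 - x y)
    = w (1 - x)^2 removes the denominator. The factor 1 + x is what makes the rest a difference: x
    (1 - w) + (1 - x y) = (1 + x) (1 - y). *)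
Lemma rhs_term_step M n : (n < M.+1)%N ->
  (1 - q ^+ M.+1) *
    (qpoch q q M.+1 ^+ 2 * rhs_term q M.+1 n.+1
      - qpoch q q M ^+ 2 * rhs_term q M n.+1) =
  qpoch q q M ^+ 2 * q ^+ M.+1 * (rhs_cert q M n.+1 - rhs_cert q M n).
Proof.
move=> lt_nM; rewrite /rhs_term /rhs_cert qpochS.
have uc : (1 - q ^+ n.+1) ^+ 2 \is a GRing.unit by rewrite unitrX ?unit_1Bq.
have -> : (n.+1 * (n.+1 + 1) %/ 2 = n * (n + 1) %/ 2 + n.+1)%N.
  have -> : (n.+1 * (n.+1 + 1) = n * (n + 1) + n.+1 * 2)%N by lia.
  by rewrite addnC divnMDl // addnC.
have -> : M%:Z - n%:Z = M.+1%:Z - n.+1%:Z by lia.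
have -> : M%:Z + n.+2%:Z = M.+1%:Z + n.+1%:Z by lia.
rewrite (inv_qpochqq_subS M n.+1) //.
have -> : inv_qpochqq q (M%:Z + n.+1%:Z) =
    (1 - q ^+ n.+1 * q ^+ M.+1) * inv_qpochqq q (M.+1%:Z + n.+1%:Z).
  by rewrite -exprD [(n.+1 + _)%N]addnC; exact: inv_qpochqqS.
(* Once q^(M+1) is written as w x, the powers of q that remain can be treated as independent
   variables. *)
have <- : q ^+ (M.+1 - n.+1) * q ^+ n.+1 = q ^+ M.+1.
  by rewrite -exprD subnK.
rewrite (exprS (-1)) (exprD _ _ n.+1).
move: (inv_qpochqq _ _) (inv_qpochqq _ _) uc => p r.
move: (q ^+ _) (q ^+ (_ %/ _)) (q ^+ n.+1) ((-1) ^+ n) => w Q x s uc.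
move: (qpoch q q M) => P; apply: (mulIr uc).
rewrite -[RHS]mulrA mulrBr !mulrA -mulrBl -mulrA divrK //.
by ring.
Qed.

(** Telescoping leaves two boundary terms. The one at N+1 is kept here; for power series it is
    divisible by q^(N+1) and disappears in the limit. *)
Lemma partial_lhs_sum_step M N :
  (1 - q ^+ M.+1) * ((1 - q ^+ M.+1) * \sum_(1 <= n < N.+1) lhs_term q M.+1 n
    - \sum_(1 <= n < N.+1) lhs_term q M n) =
  lhs_cert q M N.+1 - q ^+ M.+1 / qpoch q q M.+1.
Proof.
have <- : lhs_cert q M 1 = q ^+ M.+1 / qpoch q q M.+1.
  rewrite /lhs_cert mul1n /qpoch big_ord_recl expr0 mulr1 expr1.
  congr (_ / (_ * _)).
  by rewrite big_add1 big_mkord; apply: eq_bigr => j _; rewrite /= -exprS.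
rewrite -(telescope_sumr (lhs_cert q M)) // mulr_sumr -sumrB mulr_sumr.
by rewrite !big_nat; apply: eq_bigr => n /andP[n_gt0 _]; rewrite lhs_term_step.
Qed.

(** The upper boundary term [rhs_cert q M M.+1] contains 1/(q;q)_(-1) = 0, and the lower one is
    1/((q;q)_M (q;q)_(M+1)). *)
Lemma finite_rhs_sum_step M :
  (1 - q ^+ M.+1) *
    (qpoch q q M.+1 ^+ 2 * \sum_(1 <= n < M.+2) rhs_term q M.+1 n
      - qpoch q q M ^+ 2 * \sum_(1 <= n < M.+2) rhs_term q M n) =
  - (qpoch q q M * q ^+ M.+1 / qpoch q q M.+1).
Proof.
rewrite !mulr_sumr -sumrB mulr_sumr big_add1 /=.
rewrite (eq_big_nat _ _ (F2 := fun n =>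
  qpoch q q M ^+ 2 * q ^+ M.+1 *
    (rhs_cert q M n.+1 - rhs_cert q M n))); last first.
  by move=> n /andP[_ ltnM]; rewrite rhs_term_step.
rewrite -mulr_sumr telescope_sumr // {1}/rhs_cert.
have -> : M%:Z - M.+1%:Z = Negz 0 by lia.
rewrite mulr0 mul0r /rhs_cert subr0.
rewrite mul0n div0n expr0 sub0r mulrN -PoszD addn1 !mul1r /=.
by rewrite expr2 -!mulrA (mulrCA (q ^+ _)) mulVKr ?qpoch_unit.
Qed.

Lemma geometric_sum (x : A) N :
  (1 - x) * \sum_(1 <= m < N.+1) x ^+ m = x - x ^+ N.+1.
Proof.
elim: N => [|N IHN]; first by rewrite big_geq // mulr0 expr1 subrr.
by rewrite big_nat_recr //= mulrDr IHN !exprS; ring.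
Qed.

Lemma arith_geometric_sum (x : A) N :
  (1 - x) ^+ 2 * \sum_(1 <= m < N.+1) m%:R * x ^+ m =
  x - x ^+ N.+1 * (N.+1%:R - N%:R * x).
Proof.
elim: N => [|N IHN].
  by rewrite big_geq // mulr0 expr1 mul0r subr0 mulr1 subrr.
by rewrite big_nat_recr //= mulrDr IHN !exprS -!natr1; ring.
Qed.

(** The induction step as pure algebra, primes marking M+1: after multiplication by [1 - y], both
    [P * S] and [P ^+ 2 * H] change by [- (P * e)]. *)
Lemma combine_steps (y P P' e S S' G H H' : A) : 1 - y \is a GRing.unit ->
  P' = P * (1 - y) -> P * S = G + P ^+ 2 * H ->
  (1 - y) * ((1 - y) * S' - S) = - e ->
  (1 - y) * (P' ^+ 2 * H' - P ^+ 2 * H) = - (P * e) ->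
  P' * S' = G + P' ^+ 2 * H'.
Proof.
move=> uy defP' PS step_lhs step_rhs; apply: (mulrI uy).
have -> : (1 - y) * (P' * S') =
    P * ((1 - y) * ((1 - y) * S' - S)) + (1 - y) * (P * S).
  by rewrite defP'; ring.
have -> : (1 - y) * (G + P' ^+ 2 * H') =
    (1 - y) * (P' ^+ 2 * H' - P ^+ 2 * H) + (1 - y) * (G + P ^+ 2 * H).
  by ring.
by rewrite step_lhs step_rhs PS mulrN.
Qed.

End Telescoping.

Set Implicit Arguments.
Unset Strict Implicit.

(** * Order of vanishing and infinite sums in R[[q]] *)

Section PowerSeries.
Variable R : comUnitRingType.
Implicit Types (f g : fps R) (F : nat -> fps R).

Local Notation q := (fpsX R).
Local Notation pos := [set n : nat | (1 <= n)%N]%classic.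

Lemma fcoefD f g k : fcoef (f + g) k = fcoef f k + fcoef g k.
Proof. by []. Qed.

Lemma fcoefB f g k : fcoef (f - g) k = fcoef f k - fcoef g k.
Proof. by []. Qed.

Lemma fcoef_sum (s : seq nat) F k :
  fcoef (\sum_(n <- s) F n) k = \sum_(n <- s) fcoef (F n) k.
Proof. exact: (big_morph (fun f => fcoef f k)). Qed.

(** This is divisibility by q^N; limits are replaced by congruences modulo q^N for all N. *)
Definition vanishes_below (N : nat) f := forall k, (k < N)%N -> fcoef f k = 0.

Lemma vanishes_belowD N f g :
  vanishes_below N f -> vanishes_below N g -> vanishes_below N (f + g).
Proof. by move=> f0 g0 k kN; rewrite fcoefD f0 // g0 // addr0. Qed.

Lemma vanishes_belowB N f g :
  vanishes_below N f -> vanishes_below N g -> vanishes_below N (f - g).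
Proof. by move=> f0 g0 k kN; rewrite fcoefB f0 // g0 // subr0. Qed.

Lemma vanishes_belowMl N f g :
  vanishes_below N g -> vanishes_below N (f * g).
Proof.
move=> g0 k kN; rewrite [LHS]/=; apply: big1 => i _.
by rewrite g0 ?mulr0 // (leq_ltn_trans (leq_subr _ _)).
Qed.

Lemma vanishes_belowMr N f g :
  vanishes_below N f -> vanishes_below N (f * g).
Proof. by move=> f0; rewrite mulrC; apply: vanishes_belowMl. Qed.

Lemma vanishes_below_sum N (s : seq nat) F :
  (forall n, n \in s -> vanishes_below N (F n)) ->
  vanishes_below N (\sum_(n <- s) F n).
Proof.
by move=> F0 k kN; rewrite fcoef_sum big_seq big1 // => n /F0 ->.
Qed.

Lemma vanishes_below_eq0 f : (forall N, vanishes_below N.+1 f) -> f = 0.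
Proof. by move=> f0; apply/fpsP => k; rewrite (f0 k). Qed.

Lemma fcoef_qXn N k : fcoef (q ^+ N) k = (k == N)%:R.
Proof.
elim: N k => [//|N IHN] k; rewrite exprS [LHS]/=.
rewrite big_ord_recl mul0r add0r; case: k => [|k]; first by rewrite big_ord0.
rewrite big_ord_recl mul1r big1 ?addr0 => [|i _]; last by rewrite mul0r.
by rewrite subSS subn0 IHN.
Qed.

Lemma vanishes_below_qXn n m : (n <= m)%N -> vanishes_below n (q ^+ m).
Proof.
by move=> le_nm k lt_kn; rewrite fcoef_qXn ltn_eqF // (leq_trans lt_kn).
Qed.

Lemma unit_1BqX n : (0 < n)%N -> 1 - q ^+ n \is a GRing.unit.
Proof.
(* A unit of R[[q]] is by definition a series whose constant coefficient is a unit. *)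
move=> n_gt0; change (fcoef (1 - q ^+ n) 0 \is a GRing.unit).
by rewrite fcoefB fcoef_qXn ltn_eqF // subr0 unitr1.
Qed.

Lemma vanishing_summable F :
  (forall n, (0 < n)%N -> vanishes_below n (F n)) -> fps_summable pos F.
Proof.
move=> F0 k; apply: (@sub_finite_set _ _ `I_k.+1); last exact: finite_II.
move=> n /= [n_gt0 Fnk]; rewrite ltnS leqNgt; apply/negP => lt_kn.
by apply: Fnk; apply: F0.
Qed.

Lemma fcoef_fps_sum F N k : (forall n, (N < n)%N -> fcoef (F n) k = 0) ->
  fcoef (fps_sum pos F) k = fcoef (\sum_(1 <= n < N.+1) F n) k.
Proof.
move=> F0; rewrite fcoef_sum /=.
rewrite (fsbigE (index_iota 1 N.+1)) ?iota_uniq //.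
- rewrite big_seq_cond [RHS]big_seq; apply: eq_bigl => n.
  rewrite mem_index_iota; case: (boolP (0 < n < N.+1)%N) => // /andP[n_gt0 _].
  by rewrite mem_set.
- by move=> n /=; rewrite mem_index_iota => /andP[].
- move=> n n_gt0; rewrite mem_index_iota n_gt0 /= -leqNgt; exact: F0.
Qed.

Lemma fps_sum_finite F N : (forall n, (N < n)%N -> F n = 0) ->
  fps_sum pos F = \sum_(1 <= n < N.+1) F n.
Proof.
by move=> F0; apply/fpsP => k; apply: fcoef_fps_sum => n /F0 ->.
Qed.

Lemma fps_sum_tail F N :
  (forall n, (0 < n)%N -> vanishes_below n (F n)) ->
  vanishes_below N.+1 (fps_sum pos F - \sum_(1 <= n < N.+1) F n).
Proof.
move=> F0 k le_kN; rewrite fcoefB (@fcoef_fps_sum F N) ?subrr // => n lt_Nn.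
by apply: F0; [apply: leq_ltn_trans lt_Nn | apply: leq_trans lt_Nn].
Qed.

(** * Passage to infinite sums and the induction on M *)

Definition lambert_term n : fps R := n%:R * q ^+ n / (1 - q ^+ n).

Lemma lhs_term_vanishes M n : vanishes_below n (lhs_term q M n).
Proof. exact/vanishes_belowMr/vanishes_below_qXn/leq_addl. Qed.

Lemma lambert_term_vanishes n : vanishes_below n (lambert_term n).
Proof. exact/vanishes_belowMr/vanishes_belowMl/vanishes_below_qXn. Qed.

Lemma lhs_cert_vanishes M n : vanishes_below n (lhs_cert q M n).
Proof. exact/vanishes_belowMr/vanishes_below_qXn/leq_pmulr. Qed.

Lemma rhs_term_eq0 M n : (M < n)%N -> rhs_term q M n = 0.
Proof.
move=> lt_Mn; rewrite /rhs_term.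
have -> : M%:Z - n%:Z = Negz (n - M.+1) by lia.
by rewrite mulr0 !mul0r.
Qed.

(** Expanding q^n / (1 - q^n)^2 as the sum of m q^(mn), and q^n / (1 - q^n) as the sum of q^(nm),
    gives the same double series with the indices exchanged. *)
Lemma lhs_sum0 : fps_sum pos (lhs_term q 0) = fps_sum pos lambert_term.
Proof.
apply/subr0_eq/vanishes_below_eq0 => N.
(* The double series cut off to a square, which agrees with both partial sums modulo q^(N+1). *)
set D := \sum_(1 <= n < N.+1) \sum_(1 <= m < N.+1) n%:R * q ^+ (n * m).
have DF : vanishes_below N.+1 (\sum_(1 <= n < N.+1) lhs_term q 0 n - D).
  rewrite /D exchange_big_nat -sumrB /=; apply: vanishes_below_sum => n.
  rewrite mem_index_iota => /andP[n_gt0 _].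
  have ux := unit_1BqX n_gt0.
  have -> : \sum_(1 <= m < N.+1) m%:R * q ^+ (m * n) =
      ((1 - q ^+ n) ^+ 2)^-1 * (q ^+ n -
        (q ^+ n) ^+ N.+1 * (N.+1%:R - N%:R * q ^+ n)).
    rewrite -arith_geometric_sum mulKr ?unitrX //.
    by apply: eq_bigr => m _; rewrite mulnC exprM.
  rewrite /lhs_term muln0 add0n big_geq // mulr1 mulrC -mulrBr.
  rewrite opprB addrCA subrr addr0 -exprM.
  exact/vanishes_belowMl/vanishes_belowMr/vanishes_below_qXn/leq_pmull.
have DG : vanishes_below N.+1 (\sum_(1 <= n < N.+1) lambert_term n - D).
  rewrite /D -sumrB; apply: vanishes_below_sum => n.
  rewrite mem_index_iota => /andP[n_gt0 _].
  have ux := unit_1BqX n_gt0.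
  have -> : \sum_(1 <= m < N.+1) n%:R * q ^+ (n * m) =
      n%:R * ((1 - q ^+ n)^-1 * (q ^+ n - (q ^+ n) ^+ N.+1)).
    rewrite -geometric_sum mulKr // mulr_sumr.
    by apply: eq_bigr => m _; rewrite exprM.
  rewrite /lambert_term -mulrA [q ^+ n / _]mulrC -!mulrBr.
  rewrite opprB addrCA subrr addr0 -exprM.
  exact/vanishes_belowMl/vanishes_belowMl/vanishes_below_qXn/leq_pmull.
have TF := @fps_sum_tail _ N (fun n _ => @lhs_term_vanishes 0 n).
have TG := @fps_sum_tail _ N (fun n _ => @lambert_term_vanishes n).
have := vanishes_belowB (vanishes_belowD TF DF) (vanishes_belowD TG DG).
by rewrite !addrA !subrK opprB addrA subrK.
Qed.

Lemma lhs_sum_step M :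
  (1 - q ^+ M.+1) * ((1 - q ^+ M.+1) * fps_sum pos (lhs_term q M.+1)
    - fps_sum pos (lhs_term q M)) = - (q ^+ M.+1 / qpoch q q M.+1).
Proof.
apply/subr0_eq/vanishes_below_eq0 => N.
have T m := @fps_sum_tail _ N (fun n _ => @lhs_term_vanishes m n).
(* Here [f], [f'] are the infinite sums, [S], [S'] their partial sums and [u] the boundary term at
   N+1: the error is a combination of the tails, plus [u]. *)
have eq_tails (y e f f' S S' u : fps R) : y * (y * S' - S) = u - e ->
    y * (y * f' - f) - - e = y * (y * (f' - S') - (f - S)) + u.
  by move=> defu; rewrite -[u](subrK e) -defu; ring.
rewrite (eq_tails _ _ _ _ _ _ _ (partial_lhs_sum_step _ q unit_1BqX M N)).
apply: vanishes_belowD; last exact: lhs_cert_vanishes.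
exact/vanishes_belowMl/vanishes_belowB/T/vanishes_belowMl/T.
Qed.

Lemma lhs_sumE M :
  qpoch q q M * fps_sum pos (lhs_term q M) =
  fps_sum pos lambert_term + qpoch q q M ^+ 2 * fps_sum pos (rhs_term q M).
Proof.
elim: M => [|M IHM].
  rewrite lhs_sum0 (@fps_sum_finite (rhs_term q 0) 0);
    last by move=> n; apply: rhs_term_eq0.
  by rewrite big_geq // mulr0 addr0 /qpoch big_ord0 mul1r.
(* The common range 1 <= n <= M+1 serves both m = M and m = M+1, as the extra term for m = M is
   0. *)
have finS m : (m <= M.+1)%N ->
    \sum_(1 <= n < M.+2) rhs_term q m n = fps_sum pos (rhs_term q m).
  move=> le_mM; rewrite (@fps_sum_finite (rhs_term q m) M.+1) // => n lt_Mn.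
  by apply: rhs_term_eq0; apply: leq_ltn_trans lt_Mn.
have step_rhs := finite_rhs_sum_step _ q unit_1BqX M.
rewrite (finS _ (leqnn _)) (finS _ (leqnSn _)) -mulrA in step_rhs.
apply: combine_steps (qpochS _ q M) IHM (lhs_sum_step M) step_rhs.
exact: unit_1BqX.
Qed.

End PowerSeries.

Unset Implicit Arguments.
Set Strict Implicit.

Theorem theorem3p1 (R : comUnitRingType) (M : nat) :
  let q := fpsX R in
  let pos := [set n : nat | (1 <= n)%N]%classic in
  let F := fun n : nat =>
    q ^+ (n * M + n)
      / ((1 - q ^+ n) ^+ 2 * \prod_(1 <= j < M.+1) (1 - q ^+ (n + j))) in
  let G := fun n : nat => n%:R * q ^+ n / (1 - q ^+ n) in
  let H := fun n : nat =>
    (-1) ^+ n * q ^+ (n * (n + 1) %/ 2) * (1 + q ^+ n)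
      * inv_qpochqq q (M%:Z - n%:Z) * inv_qpochqq q (M%:Z + n%:Z)
      / (1 - q ^+ n) ^+ 2 in
  [/\ fps_summable pos F, fps_summable pos G, fps_summable pos H &
      fps_sum pos F =
        (qpoch q q M)^-1 * fps_sum pos G + qpoch q q M * fps_sum pos H].
Proof.
move=> q pos F G H; split.
- by apply: vanishing_summable => n _; apply: lhs_term_vanishes.
- by apply: vanishing_summable => n _; apply: lambert_term_vanishes.
- apply: vanishing_summable => n _; rewrite /H.
  (* The power of q in the numerator suffices, since n <= n(n+1)/2. *)
  do 4 apply: vanishes_belowMr; apply/vanishes_belowMl/vanishes_below_qXn.
  by rewrite leq_divRL // leq_mul2l; lia.
have uP : qpoch q q M \is a GRing.unit.
  by apply: qpoch_unit => n; apply: unit_1BqX.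
by rewrite -(mulKr uP (fps_sum pos F)) lhs_sumE mulrDr expr2 -mulrA mulKr.
Qed.
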